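(* Let $n\ge1$ and $\lambda\in\mathbb{C}^n$. For every $s\ge1$ the $s$-linear operator $\Lambda_s$ on $\mathcal{F}$ satisfies $$\Lambda_s=\sum_{t\in\mathcal{T}_s^\circ}\mu_t\,Q[t],$$ where, for a marked full binary tree $t$ with $s$ leaves and backslash code $b(t)=(c_{11},\ldots,c_{1\,i_1+1})(c_{21},\ldots,c_{2\,i_2+1})\ldots(c_{s1},\ldots,c_{s\,i_s+1})$, $$\mu_t=\prod_{k=1}^s L_{c_{k1}}L_{c_{k2}}\cdots L_{c_{k\,i_k}}\,J_{c_{k\,i_k+1}},\qquad L_m=-\frac{B_m}{m!}\ (m\ge1),\quad J_{m+1}=\frac{(-1)^mB_m}{m!}\ (m\ge0),$$ and $B_m$ is the $m$-th Bernoulli number ($\frac{x}{e^x-1}=\sum_{m\ge0}B_m\frac{x^m}{m!}$, so $B_1=-\frac12$).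
   Context: $\mathcal{F}$ is the space of formal power series $\sum f_{\alpha\beta}x^\alpha y^\beta$, $|\alpha|+|\beta|\ge3$, with complex coefficients in $x=(x_1,\dots,x_n)$, $y=(y_1,\dots,y_n)$. Poisson bracket: $\{F_1,F_2\}=\sum_{j=1}^n\bigl(\frac{\partial F_1}{\partial y_j}\frac{\partial F_2}{\partial x_j}-\frac{\partial F_1}{\partial x_j}\frac{\partial F_2}{\partial y_j}\bigr)$. With $\langle\gamma,\lambda\rangle=\sum_j\gamma_j\lambda_j$, the operators $\mathcal{A},\mathcal{B}$ on $\mathcal{F}$ are $$\mathcal{A}F=\sum_{\langle\alpha-\beta,\lambda\rangle=0}f_{\alpha\beta}x^\alpha y^\beta,\qquad \mathcal{B}F=\sum_{\langle\alpha-\beta,\lambda\rangle\ne0}\frac{f_{\alpha\beta}}{\langle\alpha-\beta,\lambda\rangle}x^\alpha y^\beta .$$ Definition of $\Lambda_s$ (these are the operators through which the homogeneous parts of the normal form are computed, $N_m=\sum_{s=1}^{m-2}\sum_{j_1+\ldots+j_s=m-2+2s}\mathcal{A}\Lambda_s(H_{j_1},\ldots,H_{j_s})$): for an $s_1$-linear operator $P$ and an $s_2$-linear operator $R$ on $\mathcal{F}$, $\{P,R\}$ denotes the $(s_1+s_2)$-linear operator $(G_1,\ldots,G_{s_1+s_2})\mapsto\{P(G_1,\ldots,G_{s_1}),R(G_{s_1+1},\ldots,G_{s_1+s_2})\}$; $\mathcal{A}P,\mathcal{B}P$ denote compositions; $I$ is the identity operator. Then $\Lambda_1=I$ and, for $s\ge2$,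 $$\Lambda_s=\sum_{k\ge1}\frac1{k!}\sum_{s_1+\ldots+s_k=s-1}\{\mathcal{B}\Lambda_{s_1},\{\mathcal{B}\Lambda_{s_2},\ldots\{\mathcal{B}\Lambda_{s_k},I\}\ldots\}\}+\sum_{k\ge1}\frac1{(k+1)!}\sum_{s_1+\ldots+s_{k+1}=s}\{\mathcal{B}\Lambda_{s_1},\{\mathcal{B}\Lambda_{s_2},\ldots\{\mathcal{B}\Lambda_{s_k},(\mathcal{A}-I)\Lambda_{s_{k+1}}\}\ldots\}\},$$ with all $s_i\ge1$. Trees: a full binary tree is a rooted plane tree in which every vertex has either $0$ children (a leaf) or $2$ children (left and right); leaves are ordered from left to right. A marked full binary tree is a full binary tree in which some (possibly none) of the non-leaf vertices carry a mark $\circ$. $\mathcal{T}_s^\circ$ is the set of marked full binary trees with $s$ leaves. $\tau$ is the one-vertex tree. For marked trees $t',t''$, let $t't''$ (resp. $t'\circ t''$) be the tree with an unmarked (resp. marked) root whose left subtree is $t'$ and right subtree is $t''$; every $t\ne\tau$ has exactly one of these forms, uniquely. $Q[t]$: for $t\in\mathcal{T}^\circ_m$, $Q[t]$ is the $m$-linear operator on $\mathcal{F}$ determined by $Q[\tau](G)=G$, $Q[t't'']=\{\mathcal{B}Q[t'],Q[t'']\}$, $Q[t'\circ t'']=\{\mathcal{B}Q[t'],\mathcal{A}Q[t'']\}$. Backslash code: for $t\in\mathcal{T}_s^\circ$ and $k=1,\ldots,s$, the backslash line $l_k$ consists of the vertices of $t$ from which one arrives at the $k$-th leaf by repeatedly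 passing to the right child (zero or more times). Every vertex lies on exactly one of these lines. Order the $j_k$ vertices of $l_k$ from top to bottom (i.e. left to right, the last one being the $k$-th leaf), and let $s_{k1}<\ldots<s_{k\,i_k}$ be the positions of the marked vertices. The code of $l_k$ is $(c_{k1},\ldots,c_{k\,i_k+1})$ with $c_{k1}=s_{k1}$, $c_{k2}=s_{k2}-s_{k1}$, ..., $c_{k\,i_k}=s_{k\,i_k}-s_{k\,i_k-1}$, $c_{k\,i_k+1}=j_k-s_{k\,i_k}$ (if $i_k=0$ the code is $(j_k)$). The backslash code $b(t)$ is the sequence of codes of $l_1,\ldots,l_s$. *)

(* Defs.v *)
(* MathComp world. The complex numbers are R[i] for an arbitrary R : realType. *)
From HB Require Import structures.
From mathcomp Require Import all_boot all_order all_algebra.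
From mathcomp Require Import complex mpoly.
From mathcomp Require Import ring.
From mathcomp Require Import boolp functions reals.
Set Implicit Arguments.
Unset Strict Implicit.
Unset Printing Implicit Defensive.
Import Order.TTheory GRing.Theory Num.Theory.
Local Open Scope ring_scope.

Section Bernoulli.
Local Open Scope nat_scope.

(* bernoulli_seq m = [:: B_0; ...; B_m] *)
Fixpoint bernoulli_seq (m : nat) : seq rat :=
  if m is m'.+1 then
    let bs := bernoulli_seq m' in
    rcons bs (- (\sum_(k < m) 'C(m.+1, k)%:R * bs`_k) / m.+1%:R)%R
  else [:: 1%R].

Definition bernoulli (m : nat) : rat := (bernoulli_seq m)`_m.

Lemma size_bernoulli_seq m : size (bernoulli_seq m) = m.+1.
Proof. by elim: m => //= m IHm; rewrite size_rcons IHm. Qed.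

Lemma nth_bernoulli_seq m k :
  k <= m -> ((bernoulli_seq m)`_k = bernoulli k)%R.
Proof.
elim: m => [|m IHm]; first by rewrite leqn0 => /eqP->.
rewrite leq_eqVlt => /orP[/eqP->//|km]; rewrite -IHm //=.
by rewrite nth_rcons size_bernoulli_seq km.
Qed.

Lemma bernoulli0 : bernoulli 0 = 1%R. Proof. by []. Qed.

Lemma bernoulliS m :
  (bernoulli m.+1 =
   - (\sum_(k < m.+1) 'C(m.+2, k)%:R * bernoulli k) / m.+2%:R)%R.
Proof.
rewrite {1}/bernoulli /= nth_rcons size_bernoulli_seq ltnn eqxx.
by congr (- _ / _)%R; apply: eq_bigr => k _; rewrite nth_bernoulli_seq // -ltnS.
Qed.

(* (e^x - 1) * \sum_m B_m x^m / m! = x, compared at x^N *)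
Lemma bernoulli_generating (N : nat) :
  (\sum_(i < N.+1) (if i == 0 :> nat then 0 else (i`!%:R)^-1) *
      (bernoulli (N - i) / (N - i)`!%:R) = (N == 1)%:R :> rat)%R.
Proof.
have fact_neq0 k : (k`!%:R != 0 :> rat)%R by rewrite pnatr_eq0 -lt0n fact_gt0.
case: N => [|N]; first by rewrite big_ord1 mul0r.
have step : (\sum_(k < N.+1) 'C(N.+1, k)%:R * bernoulli k
             = (N == 0)%:R :> rat)%R.
  case: N => [|N]; first by rewrite big_ord1 mul1r.
  rewrite big_ord_recr /= bernoulliS binSn mulrCA divff ?mulr1 ?subrr //.
  by rewrite pnatr_eq0.
rewrite big_ord_recl /= mul0r add0r.
rewrite (reindex_inj rev_ord_inj) /=.
have E (k : 'I_N.+1) : ((lift ord0 (rev_ord k))`!%:R^-1 *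
    (bernoulli (N.+1 - lift ord0 (rev_ord k)) /
     (N.+1 - lift ord0 (rev_ord k))`!%:R)
    = 'C(N.+1, k)%:R * bernoulli k / (N.+1)`!%:R :> rat)%R.
  have kN1 : k <= N.+1 by apply: ltnW.
  have -> : nat_of_ord (lift ord0 (rev_ord k)) = N.+1 - k.
    by rewrite /= /bump leq0n add1n -subSn // ltn_ord.
  rewrite subKn // -(bin_fact kN1) !natrM.
  have c0 : ('C(N.+1, k)%:R != 0 :> rat)%R.
    by rewrite pnatr_eq0 -lt0n bin_gt0.
  by field; rewrite c0 !fact_neq0.
under eq_bigr => k _ do rewrite E.
rewrite -mulr_suml step; case: N {E step} => [|N] //=.
by rewrite mul0r.
Qed.

End Bernoulli.

Definition L_coef (m : nat) : rat := - bernoulli m / m`!%:R.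

(* J_coef m.+1 = (-1)^m B_m / m!; only used at positive indices *)
Definition J_coef (m : nat) : rat := (-1) ^+ m.-1 * bernoulli m.-1 / m.-1`!%:R.

(* Node b l r has a marked root iff b = true. *)
Inductive mtree : Type := Leaf | Node of bool & mtree & mtree.

Fixpoint nleaves (t : mtree) : nat :=
  if t is Node _ l r then (nleaves l + nleaves r)%N else 1%N.

Section MarkedTreesFinite.
Local Open Scope nat_scope.

Fixpoint mtree_code (t : mtree) : GenTree.tree bool :=
  if t is Node b l r
  then GenTree.Node 0 [:: GenTree.Leaf b; mtree_code l; mtree_code r]
  else GenTree.Node 1 [::].

Fixpoint mtree_decode (c : GenTree.tree bool) : option mtree :=
  match c with
  | GenTree.Node 0 [:: GenTree.Leaf b; l; r] =>
      if mtree_decode l is Some l' then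
        if mtree_decode r is Some r' then Some (Node b l' r') else None
      else None
  | GenTree.Node 1 [::] => Some Leaf
  | _ => None
  end.

Lemma mtree_codeK : pcancel mtree_code mtree_decode.
Proof. by elim=> //= b l -> r ->. Qed.

HB.instance Definition _ := Countable.copy mtree (pcan_type mtree_codeK).

Record marked_tree (s : nat) : Type :=
  MarkedTree { mtree_val :> mtree; _ : nleaves mtree_val == s }.

HB.instance Definition _ (s : nat) := [isSub for @mtree_val s].
HB.instance Definition _ (s : nat) := [Countable of marked_tree s by <:].

Fixpoint mtree_enum (d : nat) : seq mtree :=
  if d is d'.+1 then
    Leaf :: [seq Node true l r | l <- mtree_enum d', r <- mtree_enum d']
         ++ [seq Node false l r | l <- mtree_enum d', r <- mtree_enum d']
  else [::].

Lemma nleaves_gt0 t : 0 < nleaves t.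
Proof. by elim: t => //= b l IHl r _; rewrite ltn_addr. Qed.

Lemma mem_mtree_enum d t : nleaves t <= d -> t \in mtree_enum d.
Proof.
elim: d t => [|d IHd] t; first by rewrite leqNgt nleaves_gt0.
case: t => [|b l r] //= le_d; rewrite inE mem_cat.
have ld : l \in mtree_enum d.
  by apply: IHd; rewrite -ltnS (leq_trans _ le_d) // -addn1 leq_add2l nleaves_gt0.
have rd : r \in mtree_enum d.
  by apply: IHd; rewrite -ltnS (leq_trans _ le_d) // -add1n leq_add2r nleaves_gt0.
by case: b {le_d}; rewrite (allpairs_f _ ld rd) ?orbT.
Qed.

Definition marked_tree_enum (s : nat) : seq (marked_tree s) :=
  pmap insub (undup (mtree_enum s)).

Lemma marked_tree_enumP s : Finite.axiom (marked_tree_enum s).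
Proof.
apply: Finite.uniq_enumP; first by rewrite pmap_sub_uniq ?undup_uniq.
move=> t; rewrite mem_pmap_sub mem_undup mem_mtree_enum //.
by rewrite (eqP (valP t)).
Qed.

HB.instance Definition _ (s : nat) :=
  isFinite.Build (marked_tree s) (@marked_tree_enumP s).

End MarkedTreesFinite.

Section BackslashCode.
Local Open Scope nat_scope.

(* A vertex is encoded by the path leading to it from the root:
   false = left child, true = right child. *)
Fixpoint leaf_paths (t : mtree) : seq (seq bool) :=
  if t is Node _ l r then
    [seq false :: p | p <- leaf_paths l] ++ [seq true :: p | p <- leaf_paths r]
  else [:: [::]].

Fixpoint marked_at (t : mtree) (v : seq bool) : bool :=
  match t, v with
  | Node b _ _, [::] => b
  | Node _ l r, d :: v' => if d then marked_at r v' else marked_at l v'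
  | Leaf, _ => false
  end.

(* The vertices, from top to bottom, from which the leaf p is reached by going
   only to the right. *)
Definition backslash_line (p : seq bool) : seq (seq bool) :=
  [seq take i p | i <- iota 0 (size p).+1 & all id (drop i p)].

Definition line_code (t : mtree) (p : seq bool) : seq nat :=
  let marks := [seq marked_at t v | v <- backslash_line p] in
  let j := size marks in
  let positions := [seq i <- iota 1 j | nth false marks i.-1] in
  pairmap (fun a b => b - a) 0 (rcons positions j).

Definition backslash_code (t : mtree) : seq (seq nat) :=
  [seq line_code t p | p <- leaf_paths t].

End BackslashCode.

(* Every code c is nonempty: its last entry contributes J, the others L. *)
Definition mu (t : mtree) : rat :=
  \prod_(c <- backslash_code t)
    ((\prod_(m <- take (size c).-1 c) L_coef m) * J_coef (last 0%N c)).

Section PowerSeries.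
Variables (R : realType) (n : nat).
Local Notation C := R[i].

(* f a b is the coefficient of x^a y^b. *)
Definition fps : Type := 'X_{1..n} -> 'X_{1..n} -> C.
HB.instance Definition _ := GRing.Lmodule.on fps.

Definition fps_mul (f g : fps) : fps := fun a b =>
  \sum_(a' : 'X_{1..n < (mdeg a).+1} | (a' <= a)%MM)
  \sum_(b' : 'X_{1..n < (mdeg b).+1} | (b' <= b)%MM)
    f a' b' * g (a - a')%MM (b - b')%MM.

Definition fps_dx (j : 'I_n) (f : fps) : fps :=
  fun a b => (a j).+1%:R * f (a + U_(j))%MM b.

Definition fps_dy (j : 'I_n) (f : fps) : fps :=
  fun a b => (b j).+1%:R * f a (b + U_(j))%MM.

Definition fps_poisson (f g : fps) : fps :=
  \sum_(j < n) (fps_mul (fps_dy j f) (fps_dx j g)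
                - fps_mul (fps_dx j f) (fps_dy j g)).

Definition order_ge3 : {pred fps} :=
  fun f => `[< forall a b, (mdeg a + mdeg b < 3)%N -> f a b = 0 >].

Lemma order_ge3P (f : fps) :
  reflect (forall a b, (mdeg a + mdeg b < 3)%N -> f a b = 0) (f \in order_ge3).
Proof. exact: asboolP. Qed.

Lemma order_ge3_submod_closed : submod_closed order_ge3.
Proof.
split; first by apply/order_ge3P.
move=> c f g /order_ge3P hf /order_ge3P hg; apply/order_ge3P => a b ab.
have -> : (c *: f + g) a b = c * f a b + g a b by [].
by rewrite hf // hg // mulr0 addr0.
Qed.

HB.instance Definition _ :=
  GRing.isSubmodClosed.Build C fps order_ge3 order_ge3_submod_closed.

Record F_space : Type :=
  FSpace { F_val :> fps; F_valP : F_val \in order_ge3 }.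

HB.instance Definition _ := [isSub for F_val].
HB.instance Definition _ := [Choice of F_space by <:].
HB.instance Definition _ := [SubChoice_isSubLmodule of F_space by <:].

Lemma fps_mul_low (f g : fps) :
  (forall a b, (mdeg a + mdeg b < 2)%N -> f a b = 0) ->
  (forall a b, (mdeg a + mdeg b < 2)%N -> g a b = 0) ->
  forall a b, (mdeg a + mdeg b < 3)%N -> fps_mul f g a b = 0.
Proof.
move=> hf hg a b ab; apply: big1 => a' la; apply: big1 => b' lb.
have [hlow|hge] := ltnP (mdeg a' + mdeg b') 2; first by rewrite hf ?mul0r.
rewrite hg ?mulr0 //; rewrite -(submK la) -(submK lb) !mdegD addnACA in ab.
rewrite ltnNge; apply/negP => hge2; have := leq_add hge2 hge.
by rewrite leqNgt (leq_trans ab).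
Qed.

Lemma fps_dx_low j (f : fps) : f \in order_ge3 ->
  forall a b, (mdeg a + mdeg b < 2)%N -> fps_dx j f a b = 0.
Proof.
move=> /order_ge3P hf a b ab; rewrite /fps_dx hf ?mulr0 //.
by rewrite mdegD mdeg1 addnAC addn1.
Qed.

Lemma fps_dy_low j (f : fps) : f \in order_ge3 ->
  forall a b, (mdeg a + mdeg b < 2)%N -> fps_dy j f a b = 0.
Proof.
move=> /order_ge3P hf a b ab; rewrite /fps_dy hf ?mulr0 //.
by rewrite mdegD mdeg1 addnA addn1.
Qed.

Lemma fps_poisson_order (f g : F_space) : fps_poisson f g \in order_ge3.
Proof.
apply: rpred_sum => j _; apply: rpredB; apply/order_ge3P; apply: fps_mul_low;
  by [exact: fps_dx_low (F_valP _) | exact: fps_dy_low (F_valP _)].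
Qed.

Definition poisson (f g : F_space) : F_space := FSpace (fps_poisson_order f g).

Variable lam : 'rV[C]_n.

Definition pairing (a b : 'X_{1..n}) : C :=
  \sum_(j < n) ((a j)%:R - (b j)%:R) * lam 0 j.

Definition fps_A (f : fps) : fps :=
  fun a b => if pairing a b == 0 then f a b else 0.

Definition fps_B (f : fps) : fps :=
  fun a b => if pairing a b == 0 then 0 else f a b / pairing a b.

Lemma fps_A_order (f : F_space) : fps_A f \in order_ge3.
Proof.
apply/order_ge3P => a b ab; rewrite /fps_A.
by case: ifP => // _; apply/order_ge3P: ab; apply: F_valP.
Qed.

Lemma fps_B_order (f : F_space) : fps_B f \in order_ge3.
Proof.
apply/order_ge3P => a b ab; rewrite /fps_B.
by case: ifP => // _; have /order_ge3P -> := F_valP f; rewrite ?mul0r.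
Qed.

Definition opA (f : F_space) : F_space := FSpace (fps_A_order f).
Definition opB (f : F_space) : F_space := FSpace (fps_B_order f).

(* An s-linear operator (G_1, ..., G_s) |-> P(G_1, ..., G_s) is represented by
   a function on sequences, meaningful on those of size s. *)
Definition multiop : Type := seq F_space -> F_space.

Definition op_id : multiop := head 0.

(* {P, R}, for P an s1-linear operator *)
Definition op_poisson (s1 : nat) (P Q : multiop) : multiop :=
  fun G => poisson (P (take s1 G)) (Q (drop s1 G)).

(* {B Lam_{s_1}, {B Lam_{s_2}, ... {B Lam_{s_k}, Q} ... }}
   for ss = [:: s_1; ...; s_k] *)
Definition nested_poisson (Lam : nat -> multiop) (ss : seq nat) (Q : multiop) :
    multiop :=
  foldr (fun s1 => op_poisson s1 (opB \o Lam s1)) Q ss.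

Definition is_composition (m : nat) (ss : seq nat) : bool :=
  all (leq 1) ss && (sumn ss == m).

(* The right-hand side of the recursion for Lam_s, s >= 2. The conditions
   s_i >= 1 force k < s and s_i < s in both sums. *)
Definition Lambda_rhs (Lam : nat -> multiop) (s : nat) : multiop := fun G =>
  \sum_(1 <= k < s) (k`!%:R : C)^-1 *:
     (\sum_(ss : k.-tuple 'I_s | is_composition s.-1 (map val ss))
        nested_poisson Lam (map val ss) op_id G)
  + \sum_(1 <= k < s) (k.+1`!%:R : C)^-1 *:
     (\sum_(u : k.-tuple 'I_s * 'I_s
            | is_composition s (rcons (map val u.1) (val u.2)))
        nested_poisson Lam (map val u.1)
          (fun G' => opA (Lam (val u.2) G') - Lam (val u.2) G') G).

(* Lambda_table s m is Lambda m for m <= s. *)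
Fixpoint Lambda_table (s : nat) : nat -> multiop :=
  if s is s'.+1 then
    fun m => if (m <= s')%N then Lambda_table s' m
             else if m == 1%N then op_id
             else Lambda_rhs (Lambda_table s') m
  else fun _ _ => 0.

Definition Lambda (s : nat) : multiop := Lambda_table s s.

Lemma Lambda_tableE s m : (m <= s)%N -> Lambda_table s m = Lambda m.
Proof.
elim: s => [|s IHs]; first by rewrite leqn0 => /eqP->.
by rewrite leq_eqVlt => /orP[/eqP->//|]; rewrite ltnS => ms /=; rewrite ms IHs.
Qed.

Lemma nested_poisson_ext (Lam Lam' : nat -> multiop) ss Q :
  {in ss, Lam =1 Lam'} -> nested_poisson Lam ss Q = nested_poisson Lam' ss Q.
Proof.
elim: ss => //= a ss IHss eqL; rewrite eqL ?mem_head // IHss //.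
by move=> x xss; apply: eqL; rewrite inE xss orbT.
Qed.

Lemma Lambda_1 : Lambda 1 = op_id. Proof. by []. Qed.

Lemma Lambda_rec s : (2 <= s)%N -> Lambda s = Lambda_rhs Lambda s.
Proof.
case: s => [|s] // s_gt1; rewrite {1}/Lambda /= ltnn ifN; last first.
  by rewrite eqSS -lt0n.
have eqL (i : 'I_s.+1) : Lambda_table s i = Lambda i.
  by rewrite Lambda_tableE // -ltnS.
have eqN (ss : seq 'I_s.+1) Q :
    nested_poisson (Lambda_table s) (map val ss) Q
    = nested_poisson Lambda (map val ss) Q.
  by apply: nested_poisson_ext => _ /mapP[i _ ->]; rewrite eqL.
apply/funext => G; congr (_ + _); apply: eq_bigr => k _; congr (_ *: _);
  by apply: eq_bigr => ss _; rewrite eqN ?eqL.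
Qed.

(* Q[t] *)
Fixpoint treeop (t : mtree) : multiop :=
  match t with
  | Leaf => op_id
  | Node false l r => op_poisson (nleaves l) (opB \o treeop l) (treeop r)
  | Node true l r => op_poisson (nleaves l) (opB \o treeop l) (opA \o treeop r)
  end.

End PowerSeries.

(* Main.v *)
From HB Require Import structures.
Require Import Defs.
From mathcomp Require Import all_boot all_order all_algebra.
From mathcomp Require Import complex mpoly.
From mathcomp Require Import ring.
From mathcomp Require Import boolp functions reals.
Set Implicit Arguments.
Unset Strict Implicit.
Unset Printing Implicit Defensive.
Import Order.TTheory GRing.Theory Num.Theory.
Local Open Scope ring_scope.

(* Put Lam = \sum_s Lambda_s and let X = {B Lam, -}, which raises the arity.
   With E(x) = (e^x - 1) / x, the recursion reads
     E(X) Lam = e^X I + (E(X) - 1) A Lam,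
   and applying 1 / E(X) = \sum_m B_m X^m / m! turns it into
     Lam = \sum_(m >= 0) J_(m+1) X^m I + \sum_(m >= 1) L_m X^m A Lam.
   Cutting a tree along the backslash line of its root, at the first mark of
   that line, shows that \sum_t mu_t Q[t] satisfies the same equation, and the
   arity s part of the right-hand side only involves lower arities. *)

(** * Power series *)

Section CauchyProduct.
Variable K : comNzRingType.
Implicit Types f g h : nat -> K.

Definition cauchy_prod f g : nat -> K :=
  fun n => \sum_(i < n.+1) f i * g (n - i)%N.

Definition seq_one : nat -> K := fun n => (n == 0)%:R.

(** The substitution [x -> -x]. *)
Definition alternate f : nat -> K := fun n => (-1) ^+ n * f n.

(** Below degree [N] the product sees only polynomial truncations, so commutativity and
    associativity can be taken from the polynomial ring. *)
Lemma cauchy_prod_coef f g N n : (n < N)%N ->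
  cauchy_prod f g n = ((\poly_(i < N) f i) * (\poly_(i < N) g i))`_n.
Proof.
move=> nN; rewrite coefM; apply: eq_bigr => i _.
have iN : (i < N)%N by rewrite (leq_ltn_trans _ nN) // -ltnS.
by rewrite !coef_poly iN (leq_ltn_trans (leq_subr _ _) nN).
Qed.

Lemma cauchy_prodC f g : cauchy_prod f g = cauchy_prod g f.
Proof. by apply/funext => n; rewrite !(@cauchy_prod_coef _ _ n.+1) // mulrC. Qed.

Lemma cauchy_prodA f g h :
  cauchy_prod f (cauchy_prod g h) = cauchy_prod (cauchy_prod f g) h.
Proof.
have coefE f1 f2 f3 n : cauchy_prod f1 (cauchy_prod f2 f3) n =
    ((\poly_(i < n.+1) f1 i) *
     ((\poly_(i < n.+1) f2 i) * (\poly_(i < n.+1) f3 i)))`_n.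
  rewrite coefM; apply: eq_bigr => i _.
  by rewrite coef_poly ltn_ord (@cauchy_prod_coef _ _ n.+1) // ltnS leq_subr.
apply/funext => n; rewrite (cauchy_prodC (cauchy_prod f g) h) !coefE.
by rewrite [in RHS]mulrC -mulrA.
Qed.

Lemma cauchy_prod1 f : cauchy_prod f seq_one = f.
Proof.
apply/funext => n; rewrite /cauchy_prod big_ord_recr /= subnn mulr1 big1 ?add0r //.
by move=> i _; rewrite /seq_one subn_eq0 leqNgt ltn_ord mulr0.
Qed.

Lemma cauchy_prod_alternate f g :
  cauchy_prod (alternate f) (alternate g) = alternate (cauchy_prod f g).
Proof.
apply/funext => n; rewrite /alternate mulr_sumr; apply: eq_bigr => i _.
by rewrite mulrACA -exprD subnKC // -ltnS.
Qed.

Lemma alternate1 : alternate seq_one = seq_one.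
Proof. by apply/funext => -[|n]; rewrite /alternate /seq_one ?mul1r ?mulr0. Qed.

End CauchyProduct.

(** * The exponential and Bernoulli generating series *)

Section BernoulliSeries.

Definition exp_coef (n : nat) : rat := n`!%:R^-1.
(** The series [(e^x - 1) / x], whose constant term is 1. *)
Definition expm1_coef (n : nat) : rat := n.+1`!%:R^-1.
Definition bernoulli_coef (n : nat) : rat := bernoulli n / n`!%:R.

Let fact_neq0 k : k`!%:R != 0 :> rat.
Proof. by rewrite pnatr_eq0 -lt0n fact_gt0. Qed.

(** The generating identity at [x^(n+1)], divided by [x]; its term [i = 0] is zero. *)
Lemma bernoulli_expm1 :
  cauchy_prod bernoulli_coef expm1_coef = seq_one rat.
Proof.
rewrite cauchy_prodC; apply/funext => n.
have := bernoulli_generating n.+1; rewrite big_ord_recl mul0r add0r => sumE.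
rewrite -[RHS]sumE.
by apply: eq_bigr => i _; rewrite /= /bump leq0n add1n subSS.
Qed.

(** Coefficient form of [e^x (1 - e^(-x)) = e^x - 1], divided by [x]. *)
Lemma exp_expm1_alternate :
  cauchy_prod exp_coef (alternate expm1_coef) = expm1_coef.
Proof.
(* The expansion of [(-1 + 1)^(n+1) = 0], with its top term split off, is the identity up to a
   factor [(n+1)!]. *)
apply/funext => n; have := exprDn (-1 : rat) 1 n.+1.
rewrite addNr expr0n big_ord_recr /= subnn expr0 mul1r expr1n binn => /eqP.
rewrite eq_sym addr_eq0 => /eqP sumE.
rewrite /cauchy_prod /alternate /exp_coef /expm1_coef -[RHS]mul1r.
rewrite -[X in _ = X * _]opprK -[X in _ = - X * _]sumE -sumrN mulr_suml.
apply: eq_bigr => i _; have le_in : (i <= n)%N by rewrite -ltnS.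
rewrite expr1n mulr1 subSn // exprS -(bin_fact (leqW le_in)) subSn //.
rewrite (natrM _ 'C(_, _)) (natrM _ i`!).
have c0 : 'C(n.+1, i)%:R != 0 :> rat by rewrite pnatr_eq0 -lt0n bin_gt0 ltnW.
rewrite -[_ *+ 'C(_, _)]mulr_natr; move: (fact_neq0 i) (fact_neq0 (n - i).+1) c0.
set x := i`!%:R; set y := _.+1`!%:R; set z := 'C(_, _)%:R; set w := (-1) ^+ _.
by move=> x0 y0 z0; field; rewrite x0 y0 z0.
Qed.

(* With [E = (e^x - 1) / x] one has [E(x) = e^x E(-x)], so the inverse
   [b = 1 / E] satisfies [b(x) e^x = b(-x)]. *)
Lemma bernoulli_exp :
  cauchy_prod bernoulli_coef exp_coef = alternate bernoulli_coef.
Proof.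
set b := bernoulli_coef; set e := exp_coef; set E := expm1_coef.
have b'E' : cauchy_prod (alternate b) (alternate E) = seq_one _.
  by rewrite cauchy_prod_alternate bernoulli_expm1 alternate1.
have Ee : cauchy_prod e (alternate E) = E := exp_expm1_alternate.
have bE : cauchy_prod b E = seq_one _ := bernoulli_expm1.
(* [b(-x)] is written as [b(-x) (b(x) (e^x E(-x)))], where [b(-x)] and [E(-x)] cancel. *)
rewrite -[RHS]cauchy_prod1 -bE -[in RHS]Ee.
rewrite 2!cauchy_prodA -[in RHS](cauchy_prodA (alternate b)).
rewrite [in RHS]cauchy_prodC cauchy_prodA (cauchy_prodC (alternate E)) b'E'.
by rewrite [in RHS]cauchy_prodC cauchy_prod1.
Qed.

End BernoulliSeries.

(** * Linearity of the operators *)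

Section PoissonLinear.
Variables (R : realType) (n : nat).
Local Notation C := R[i].
Implicit Types (f g h : fps R n).

Lemma fps_mul_linearl h : linear (@fps_mul R n ^~ h).
Proof.
move=> c f g; apply/funext => a; apply/funext => b.
rewrite /fps_mul -[RHS]/(c * _ + _) mulr_sumr -big_split; apply: eq_bigr => a' _.
rewrite mulr_sumr -big_split; apply: eq_bigr => b' _.
by rewrite -[(c *: f + g) _ _]/(c * _ + _) mulrDl mulrA.
Qed.

Lemma fps_mul_linearr h : linear (@fps_mul R n h).
Proof.
move=> c f g; apply/funext => a; apply/funext => b.
rewrite /fps_mul -[RHS]/(c * _ + _) mulr_sumr -big_split; apply: eq_bigr => a' _.
rewrite mulr_sumr -big_split; apply: eq_bigr => b' _.
by rewrite -[(c *: f + g) _ _]/(c * _ + _) mulrDr mulrCA.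
Qed.

Lemma fps_dx_linear j : linear (@fps_dx R n j).
Proof.
move=> c f g; apply/funext => a; apply/funext => b.
by rewrite /fps_dx -[(c *: f + g) _ _]/(c * _ + _) mulrDr mulrCA.
Qed.

Lemma fps_dy_linear j : linear (@fps_dy R n j).
Proof.
move=> c f g; apply/funext => a; apply/funext => b.
by rewrite /fps_dy -[(c *: f + g) _ _]/(c * _ + _) mulrDr mulrCA.
Qed.

Lemma poisson_linearl (h : F_space R n) : linear (@poisson R n ^~ h).
Proof.
move=> c f g; apply/val_inj.
rewrite [LHS]/= [RHS]/= /fps_poisson scaler_sumr -big_split.
apply: eq_bigr => j _ /=.
rewrite fps_dx_linear fps_dy_linear !fps_mul_linearl.
by rewrite scalerBr opprD addrACA.
Qed.

Lemma poisson_linearr (h : F_space R n) : linear (@poisson R n h).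
Proof.
move=> c f g; apply/val_inj.
rewrite [LHS]/= [RHS]/= /fps_poisson scaler_sumr -big_split.
apply: eq_bigr => j _ /=.
rewrite fps_dx_linear fps_dy_linear !fps_mul_linearr.
by rewrite scalerBr opprD addrACA.
Qed.

Variable lam : 'rV[C]_n.

Lemma opA_linear : linear (@opA R n lam).
Proof.
move=> c f g; apply/val_inj; apply/funext => a; apply/funext => b.
rewrite /= /fps_A -[RHS]/(c * (if _ then _ else _) + (if _ then _ else _)).
by case: ifP => // _; rewrite mulr0 addr0.
Qed.

Lemma opB_linear : linear (@opB R n lam).
Proof.
move=> c f g; apply/val_inj; apply/funext => a; apply/funext => b.
rewrite /= /fps_B -[RHS]/(c * (if _ then _ else _) + (if _ then _ else _)).
case: ifP => _; first by rewrite mulr0 addr0.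
by rewrite -[(c *: _ + _) _ _]/(c * _ + _) mulrDl mulrA.
Qed.

HB.instance Definition _ := GRing.isLinear.Build C _ _ _ _ opA_linear.

(** Both [Lambda] and [treeop] bracket only against images of [opB], so this one bilinear operation
    serves both. *)
Definition adB (f g : F_space R n) : F_space R n := poisson (opB lam f) g.

Lemma adB_linearl (h : F_space R n) : linear (adB ^~ h).
Proof. by move=> c f g; rewrite /adB opB_linear poisson_linearl. Qed.

Lemma adB_linearr (h : F_space R n) : linear (adB h).
Proof. by move=> c f g; rewrite /adB poisson_linearr. Qed.

HB.instance Definition _ (h : F_space R n) :=
  GRing.isLinear.Build C _ _ _ (adB h) (adB_linearr h).

Lemma adB_suml (I : Type) (r : seq I) (P : pred I) (c : I -> C)
    (F : I -> F_space R n) (h : F_space R n) :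
  adB (\sum_(i <- r | P i) c i *: F i) h = \sum_(i <- r | P i) c i *: adB (F i) h.
Proof.
pose fl := GRing.isLinear.Build C _ _ _ (adB ^~ h) (adB_linearl h).
pose f : {linear F_space R n -> F_space R n} := HB.pack (adB ^~ h) fl.
rewrite -[LHS]/(f _) linear_sum; apply: eq_bigr => i _; exact: linearZ.
Qed.

End PoissonLinear.

(** * The weight of a tree along its root line *)

Section SpineWeight.
Local Open Scope nat_scope.

(** The computation of [line_code] on an arbitrary list of marks, so that a line can be lengthened
    by vertices outside the tree. *)
Definition code_of_marks (ms : seq bool) : seq nat :=
  pairmap (fun a b => b - a) 0
    (rcons [seq i <- iota 1 (size ms) | nth false ms i.-1] (size ms)).

Definition code_weight (c : seq nat) : rat :=
  ((\prod_(m <- take (size c).-1 c) L_coef m) * J_coef (last 0%N c))%R.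

Definition line_marks (t : mtree) (p : seq bool) : seq bool :=
  [seq marked_at t v | v <- backslash_line p].

(* The weight of [t] when its root line, which ends at the path of the last
   leaf, is extended upwards by [c] unmarked vertices. *)
Definition spine_mu (c : nat) (t : mtree) : rat :=
  (\prod_(p <- leaf_paths t)
     code_weight (code_of_marks
       ((if all id p then nseq c false else [::]) ++ line_marks t p)))%R.

Lemma mu_spine t : mu t = spine_mu 0 t.
Proof.
rewrite /mu /backslash_code big_map; apply: eq_bigr => p _.
by case: all.
Qed.

(** The root lies on the line of a leaf only if the whole path goes right; the rest of the line lies
    in the subtree entered first. *)
Lemma backslash_line_cons b p :
  backslash_line (b :: p) =
  (if b && all id p then [:: [::]] else [::]) ++
  [seq b :: v | v <- backslash_line p].
Proof.
rewrite {1}/backslash_line [size _]/= (iotaD 0 1) filter_cat map_cat.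
congr (_ ++ _); first by rewrite /=; case: ifP.
by rewrite add0n (iotaDl 1 0) filter_map -!map_comp.
Qed.

Lemma line_marks_left b l r p :
  line_marks (Node b l r) (false :: p) = line_marks l p.
Proof. by rewrite /line_marks backslash_line_cons -map_comp. Qed.

Lemma line_marks_right b l r p :
  line_marks (Node b l r) (true :: p) =
  (if all id p then [:: b] else [::]) ++ line_marks r p.
Proof.
by rewrite /line_marks backslash_line_cons map_cat -map_comp; case: all.
Qed.

(** Only one line passes through the root, so a marked root contributes its factor [L] exactly
    once. *)
Lemma count_rightmost_leaf t : count (all id) (leaf_paths t) = 1.
Proof.
elim: t => //= b l _ r IHr; rewrite count_cat !count_map.
by rewrite (eq_count (a2 := pred0)) // count_pred0.
Qed.

Lemma code_of_marks_nseq c : code_of_marks (nseq c.+1 false) = [:: c.+1].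
Proof.
rewrite /code_of_marks size_nseq (@eq_filter _ _ pred0).
  by rewrite filter_pred0 /= subn0.
by move=> i; rewrite nth_nseq if_same.
Qed.

Lemma pairmap_subn_addl x a s :
  pairmap (fun a b => b - a) (x + a) [seq x + b | b <- s] =
  pairmap (fun a b => b - a) a s.
Proof. by elim: s a => //= b s IHs a; rewrite IHs subnDl. Qed.

(** Codes record differences of positions, so after the first mark, at position [c + 1], the code
    starts afresh. *)
Lemma code_of_marks_cat c ms :
  code_of_marks (nseq c false ++ true :: ms) = c.+1 :: code_of_marks ms.
Proof.
rewrite /code_of_marks size_cat size_nseq iotaD filter_cat.
rewrite (@eq_in_filter _ _ pred0) ?filter_pred0; last first.
  move=> [|i]; rewrite mem_iota // add1n => /andP[_]; rewrite ltnS => ic.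
  by rewrite nth_cat size_nseq ic nth_nseq if_same.
rewrite cat0s [size (_ :: _)]/= [iota _ _.+1]/= add1n.
rewrite [filter _ (_ :: _)]/= nth_cat size_nseq ltnn subnn /=; congr (_ :: _).
rewrite -[c.+2]addn1 (iotaDl c.+1 1) filter_map addnS -addSn.
rewrite (@eq_in_filter _ _ (fun i => nth false ms i.-1)); last first.
  move=> [|i]; rewrite mem_iota // => _ /=.
  rewrite nth_cat size_nseq addnS ltnNge leqW ?leq_addr //=.
  by rewrite subSn ?leq_addr // addKn.
by rewrite -map_rcons -[X in pairmap _ X]addn0 pairmap_subn_addl.
Qed.

(** If [c] were empty, [x] would be the last entry and contribute [J] instead of [L]. *)
Lemma code_weight_cons x c : c != [::] ->
  code_weight (x :: c) = (L_coef x * code_weight c)%R.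
Proof. by case: c => // y c _; rewrite /code_weight /= big_cons mulrA. Qed.

Lemma code_of_marks_neq0 ms : code_of_marks ms != [::].
Proof. by rewrite -size_eq0 size_pairmap size_rcons. Qed.

Lemma spine_mu_leaf c : spine_mu c Leaf = J_coef c.+1.
Proof.
rewrite /spine_mu big_seq1 -[_ ++ _]/(nseq c false ++ nseq 1 false) -nseqD addn1.
rewrite code_of_marks_nseq /code_weight /=.
by rewrite big_nil mul1r.
Qed.

(** An unmarked root prolongs the extension above [r] by one vertex, while [l] starts a line of its
    own. *)
Lemma spine_mu_unmarked c l r :
  spine_mu c (Node false l r) = (mu l * spine_mu c.+1 r)%R.
Proof.
rewrite mu_spine /spine_mu /= big_cat !big_map; congr (_ * _)%R.
  by apply: eq_bigr => p _; rewrite line_marks_left if_same.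
apply: eq_bigr => p _; rewrite line_marks_right /=; case: all => //.
by rewrite catA -[[:: false]]/(nseq 1 false) -nseqD addn1.
Qed.

(** The root carries the first mark, at position [c + 1]; beyond it the line of [r] counts as
    unextended. *)
Lemma spine_mu_marked c l r :
  spine_mu c (Node true l r) = (mu l * (L_coef c.+1 * mu r))%R.
Proof.
rewrite 2!mu_spine /spine_mu /= big_cat !big_map; congr (_ * _)%R.
  by apply: eq_bigr => p _; rewrite line_marks_left if_same.
transitivity (\prod_(p <- leaf_paths r) ((if all id p then L_coef c.+1 else 1) *
    code_weight (code_of_marks (line_marks r p))))%R.
  apply: eq_bigr => p _; rewrite line_marks_right /=; case: all.
    by rewrite code_of_marks_cat code_weight_cons ?code_of_marks_neq0.
  by rewrite mul1r.
rewrite big_split -big_mkcond big_const_seq count_rightmost_leaf /= mulr1.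
by congr (_ * _)%R; apply: eq_bigr => p _; case: all.
Qed.

End SpineWeight.

(** * Power series in the bracket *)

Section AdSeries.
Variables (R : realType) (n : nat) (lam : 'rV[R[i]]_n).
Local Notation C := R[i].
Local Notation family := (nat -> multiop R n).
Implicit Types (Lam P : nat -> multiop R n) (f g : nat -> rat).

(* [P s] is the [s]-linear component of [P]; this is [{B Lam, P}]. *)
Definition ad_sum Lam P : family := fun s G =>
  \sum_(1 <= a < s) adB lam (Lam a (take a G)) (P (s - a)%N (drop a G)).

Definition ad_iter Lam k P : family := iter k (ad_sum Lam) P.

(* [\sum_k f_k {B Lam, -}^k P]: [{B Lam, -}] raises the arity, so the terms
   [k >= s] do not contribute to arity [s]. *)
Definition ad_series f Lam P : family := fun s G =>
  \sum_(0 <= k < s) (ratr (f k) : C) *: ad_iter Lam k P s G.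

(** Each bracket spends at least one argument on [Lam] and leaves at least one, so [Lam] occurs only
    in arities below [s] and [P] only up to [s - k]. *)
Lemma ad_iter_ext Lam Lam' P P' k s G :
  (forall a, (a < s)%N -> Lam a =1 Lam' a) ->
  (forall t, (t + k <= s)%N -> P t =1 P' t) ->
  ad_iter Lam k P s G = ad_iter Lam' k P' s G.
Proof.
elim: k s G => [|k IHk] s G eqL eqP; first by apply: eqP; rewrite addn0.
apply: eq_big_nat => a /andP[a_gt0 a_lt]; rewrite eqL //; congr adB.
apply: IHk => [b b_lt|t t_le]; first exact/eqL/(leq_trans b_lt (leq_subr _ _)).
apply: eqP; rewrite addnS (leq_ltn_trans t_le) // ltn_subrL a_gt0.
exact: leq_ltn_trans a_lt.
Qed.

Lemma ad_iter_vanish Lam P k s G :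
  (forall G', P 0 G' = 0) -> (s <= k)%N -> ad_iter Lam k P s G = 0.
Proof.
move=> P0; elim: k s G => [|k IHk] s G s_le.
  by move: s_le; rewrite leqn0 => /eqP->; exact: P0.
rewrite /ad_iter iterS [LHS]big_nat_cond big1 // => a /andP[/andP[a_gt0 a_lt] _].
rewrite -[X in adB _ _ X]/(ad_iter Lam k P _ _) IHk ?linear0 //.
by rewrite leq_subLR -(prednK a_gt0) (leq_trans s_le) // addSn ltnS leq_addl.
Qed.

Lemma ad_iter_sum Lam k (I : Type) (r : seq I) (c : I -> C) (F : I -> family)
    s G :
  ad_iter Lam k (fun s G => \sum_(i <- r) c i *: F i s G) s G =
  \sum_(i <- r) c i *: ad_iter Lam k (F i) s G.
Proof.
elim: k s G => // k IHk s G; rewrite /ad_iter !iterS /ad_sum.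
under eq_bigr => a _ do rewrite -/(ad_iter _ _ _) IHk linear_sum.
rewrite exchange_big; apply: eq_bigr => i _.
by rewrite scaler_sumr; apply: eq_bigr => a _; rewrite linearZ.
Qed.

Lemma ad_iterD Lam k l P s G :
  ad_iter Lam k (ad_iter Lam l P) s G = ad_iter Lam (k + l) P s G.
Proof. by rewrite /ad_iter iterD. Qed.

Lemma ad_iter_lin Lam k (c : C) P P' s G :
  ad_iter Lam k (fun s G => c *: P s G + P' s G) s G =
  c *: ad_iter Lam k P s G + ad_iter Lam k P' s G.
Proof.
have := ad_iter_sum Lam k [:: true; false] (fun b : bool => if b then c else 1)
  (fun b : bool => if b then P else P') s G.
rewrite !big_cons big_nil addr0 scale1r => <-.
apply: ad_iter_ext => // t _ G'.
by rewrite !big_cons big_nil addr0 scale1r.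
Qed.

Lemma ad_series_widen f Lam P N s G :
  (forall G', P 0 G' = 0) -> (s <= N)%N ->
  ad_series f Lam P s G = \sum_(0 <= k < N) (ratr (f k) : C) *: ad_iter Lam k P s G.
Proof.
move=> P0 sN; rewrite [RHS](big_cat_nat (n := s)) //= [X in _ + X]big_nat_cond.
rewrite [X in _ + X]big1 ?addr0 // => k /andP[/andP[sk _] _].
by rewrite ad_iter_vanish ?scaler0.
Qed.

Lemma ad_series0 f Lam P G : ad_series f Lam P 0 G = 0.
Proof. exact: big_geq. Qed.

Lemma ad_series_lin f Lam (c : C) P P' s G :
  ad_series f Lam (fun s G => c *: P s G + P' s G) s G =
  c *: ad_series f Lam P s G + ad_series f Lam P' s G.
Proof.
rewrite /ad_series scaler_sumr -big_split; apply: eq_bigr => k _ /=.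
by rewrite ad_iter_lin scalerDr !scalerA mulrC.
Qed.

Lemma ad_series_ext f Lam P P' s G :
  (forall t, (t <= s)%N -> P t =1 P' t) ->
  ad_series f Lam P s G = ad_series f Lam P' s G.
Proof.
move=> eqP; apply: eq_bigr => k _; congr (_ *: _).
by apply: ad_iter_ext => // t ts; apply/eqP/(leq_trans _ ts)/leq_addr.
Qed.

(** Regrouping by [m = k + l]: the part of the square [k, l < s] with [k + l >= s] contributes
    nothing. *)
Lemma cauchy_prod_sum (V : lmodType C) f g (Y : nat -> V) s :
  (forall m, (s <= m)%N -> Y m = 0) ->
  \sum_(0 <= k < s) (ratr (f k) : C) *:
     \sum_(0 <= l < s) (ratr (g l) : C) *: Y (k + l)%N =
  \sum_(0 <= m < s) (ratr (cauchy_prod f g m) : C) *: Y m.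
Proof.
move=> Y0.
pose F k m : V := (ratr (f k * g (m - k)%N) : C) *: Y m.
transitivity (\sum_(0 <= k < s) \sum_(0 <= m < s) if (k <= m)%N then F k m else 0).
  apply: eq_big_nat => k /andP[_ ks].
  rewrite [in RHS](big_cat_nat (n := k)) ?(ltnW ks) //= [X in _ = X + _]big_nat_cond.
  rewrite [X in _ = X + _]big1 ?add0r; last first.
    by move=> m /andP[/andP[_ mk] _]; rewrite leqNgt mk.
  rewrite -[X in _ = \sum_(X <= _ < _) _]add0n [in RHS]big_addn scaler_sumr.
  rewrite (big_cat_nat (n := (s - k)%N)) ?leq_subr //= [X in _ + X = _]big_nat_cond.
  rewrite [X in _ + X = _]big1 ?addr0; last first.
    by move=> l /andP[/andP[kl _] _]; rewrite Y0 ?scaler0 // -leq_subLR.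
  apply: eq_bigr => l _; rewrite leq_addl /F addnK [(l + k)%N]addnC.
  by rewrite scalerA rmorphM.
rewrite exchange_big_nat; apply: eq_big_nat => m /andP[_ ms].
rewrite -big_mkcond /= /cauchy_prod rmorph_sum scaler_suml.
by rewrite -(big_mkord xpredT (fun k => F k m)) [RHS](big_nat_widen _ _ s).
Qed.

(** Turns identities between rational power series into identities between operators. *)
Lemma ad_series_comp f g Lam P s G : (forall G', P 0 G' = 0) ->
  ad_series f Lam (ad_series g Lam P) s G = ad_series (cauchy_prod f g) Lam P s G.
Proof.
move=> P0; rewrite /ad_series.
rewrite -(@cauchy_prod_sum _ f g (fun k => ad_iter Lam k P s G)); last first.
  by move=> m sm; apply: ad_iter_vanish.
apply: eq_bigr => k _; congr (_ *: _).
under [RHS]eq_bigr => l _ do rewrite -ad_iterD.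
rewrite -ad_iter_sum; apply: ad_iter_ext => // t ts G'.
(* The inner series, cut off at the smaller arity [t], is widened to the common bound [s]. *)
by apply: ad_series_widen => //; apply: leq_trans (leq_addr k t) ts.
Qed.

Lemma ad_series1 Lam P s G : (forall G', P 0 G' = 0) ->
  ad_series (seq_one rat) Lam P s G = P s G.
Proof.
move=> P0; case: s => [|s]; first by rewrite ad_series0 P0.
rewrite /ad_series big_nat_recl // big1 ?addr0 => [|k _].
  by rewrite rmorph1 scale1r.
by rewrite rmorph0 scale0r.
Qed.

End AdSeries.

(** * The functional equation of Lambda *)

Lemma big_tuple_cons (V : nmodType) (T : finType) k (F : k.+1.-tuple T -> V) :
  \sum_(u : k.+1.-tuple T) F u = \sum_(a : T) \sum_(u : k.-tuple T) F (cons_tuple a u).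
Proof.
rewrite pair_big /= (reindex (fun p : T * k.-tuple T => cons_tuple p.1 p.2)) //=.
exists (fun u => (thead u, behead_tuple u)) => [[a u] _|u _] /=.
  by congr pair; apply/val_inj.
by rewrite [RHS]tuple_eta; apply/val_inj.
Qed.

Lemma is_composition_cons s a ss :
  is_composition s (a :: ss) =
  [&& (0 < a)%N, (a <= s)%N & is_composition (s - a) ss].
Proof.
rewrite /is_composition /= -!andbA; congr andb; rewrite [RHS]andbCA; congr andb.
apply/eqP/andP => [<-|[le_as /eqP->]]; last by rewrite subnKC.
by rewrite leq_addr addKn.
Qed.

Lemma is_composition0 ss : ss != [::] -> is_composition 0 ss = false.
Proof. by case: ss => // -[|a] ss _; rewrite /is_composition /= ?andbF. Qed.

Section LambdaEquation.
Variables (R : realType) (n : nat) (lam : 'rV[R[i]]_n).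
Local Notation C := R[i].
Local Notation family := (nat -> multiop R n).
Implicit Types (Lam P : nat -> multiop R n).

Definition id_family : family := fun s => if s == 1%N then @op_id R n else fun=> 0.

(** Induction on [k], peeling off the first part. All parts must be below [N]: for [k = 0] the only
    part is [s] itself, whereas for [k > 0] every part is below [s] and [s <= N] suffices. *)
Lemma nested_poisson_sum Lam P N k s G :
  (forall G', P 0 G' = 0) -> (s < N + (0 < k))%N ->
  \sum_(ss : k.-tuple 'I_N)
    \sum_(r < N | is_composition s (rcons (map val ss) (val r)))
      nested_poisson lam Lam (map val ss) (P r) G
  = ad_iter lam Lam k P s G.
Proof.
move=> P0; elim: k s G => [|k IHk] s G; rewrite ?addn0 => s_lt.
  rewrite (big_pred1 [tuple]) => [|u]; last by apply/esym/eqP; rewrite [u]tuple0.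
  rewrite /ad_iter /=.
  case: s s_lt => [|s] s_lt.
    by rewrite P0 big_pred0 // => r; rewrite is_composition0.
  rewrite (big_pred1 (Ordinal s_lt)) // => r.
  rewrite /is_composition /= addn0 andbT -val_eqE /=.
  by case: (val r).
have {s_lt} s_le : (s <= N)%N by rewrite -ltnS -[N.+1]addn1.
rewrite big_tuple_cons /ad_iter iterS /ad_sum -/(ad_iter lam Lam k P).
transitivity (\sum_(a < N | (0 < a < s)%N)
    adB lam (Lam a (take a G)) (ad_iter lam Lam k P (s - a) (drop a G))).
  rewrite [RHS]big_mkcond; apply: eq_bigr => a _ /=.
  case: ifP => [/andP[a_gt0 a_lt]|a_out].
    rewrite -IHk; last first.
      rewrite (@leq_trans N) ?leq_addr // (leq_trans _ s_le) // ltn_subrL a_gt0.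
      exact: leq_ltn_trans a_lt.
    rewrite linear_sum; apply: eq_bigr => u _; rewrite linear_sum.
    by apply: eq_bigl => r; rewrite is_composition_cons a_gt0 (ltnW a_lt).
  (* A first part 0 is forbidden, and one that is at least [s] leaves nothing for the nonempty
     rest. *)
  apply: big1 => u _; apply: big_pred0 => r; rewrite is_composition_cons.
  case: (posnP a) a_out => //= _; case: (ltngtP a s) => // -> _.
  by rewrite subnn is_composition0 // -size_eq0 size_rcons.
rewrite -(big_mkord (fun a => 0 < a < s)%N (fun a =>
  adB lam (Lam a (take a G)) (ad_iter lam Lam k P (s - a) (drop a G)))).
case: s s_le => [|s] s_le.
  by rewrite [RHS]big_geq // big1 // => a; rewrite ltn0 andbF.
rewrite [LHS]big_mkcond big_ltn ?add0r; last exact: leq_ltn_trans s_le.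
rewrite -big_mkcond [RHS](big_nat_widen _ _ N) //=.
rewrite add0r [LHS]big_nat_cond [RHS]big_nat_cond; apply: eq_bigl => a.
by case: (0 < a)%N.
Qed.

Lemma nested_poisson0 Lam ss G : nested_poisson lam Lam ss (fun=> 0) G = 0.
Proof.
elim: ss G => //= a ss IHss G; rewrite /op_poisson IHss.
exact: (linear0 (adB lam (Lam a (take a G)))).
Qed.

(** The arity of [I] is appended as a last part 1, which turns compositions of [s - 1] into
    compositions of [s]. *)
Lemma nested_poisson_sum_id Lam N k s G : (1 < N)%N -> (s < N + (0 < k))%N ->
  (0 < s)%N ->
  \sum_(ss : k.-tuple 'I_N | is_composition s.-1 (map val ss))
      nested_poisson lam Lam (map val ss) (@op_id R n) G
  = ad_iter lam Lam k id_family s G.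
Proof.
move=> N_gt1 s_lt s_gt0; rewrite -(@nested_poisson_sum _ _ N) // big_mkcond.
apply: eq_bigr => ss _ /=; rewrite big_mkcond (bigD1 (Ordinal N_gt1)) //=.
rewrite big1 ?addr0 => [|r r_neq1]; last first.
  by case: ifP => // _; rewrite /id_family ifN // nested_poisson0.
rewrite /is_composition all_rcons sumn_rcons addn1 /=.
by rewrite -(eqSS _ s.-1) prednK.
Qed.

(** A default value, which supplies the vanishing in arity 0 that the lemmas on series ask for. *)
Lemma Lambda_0 G : Lambda lam 0 G = 0. Proof. by []. Qed.

(** The added term [k = 0] of the first sum is [I]: it yields [Lambda 1] and vanishes in all other
    arities, so one formula covers every [s]. *)
Lemma Lambda_expansion s G :
  Lambda lam s G =
  \sum_(0 <= k < s) (k`!%:R : C)^-1 *: ad_iter lam (Lambda lam) k id_family s G +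
  \sum_(1 <= k < s) (k.+1`!%:R : C)^-1 *: ad_iter lam (Lambda lam) k
       (fun s G => opA lam (Lambda lam s G) - Lambda lam s G) s G.
Proof.
have [s_gt1|] := ltnP 1 s; last first.
  case: s => [|[|s]] // _; first by rewrite !big_geq // addr0.
  by rewrite big_nat1 big_geq // addr0 fact0 invr1 scale1r.
rewrite Lambda_rec // /Lambda_rhs [in RHS]big_ltn ?(ltnW s_gt1) //.
rewrite [ad_iter _ _ 0 _ _ _]/(id_family s G) gtn_eqF // scaler0 add0r.
congr (_ + _); apply: eq_big_nat => k /andP[k_gt0 k_lt]; congr (_ *: _).
  by rewrite nested_poisson_sum_id // ?k_gt0 ?addn1 // ltnW.
rewrite -(@nested_poisson_sum _ _ s); last 2 first.
- by move=> G'; rewrite Lambda_0 linear0 subr0.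
- by rewrite k_gt0 addn1.
by rewrite pair_big_dep.
Qed.

Let opA_Lambda : family := fun s G => opA lam (Lambda lam s G).

Let opA_Lambda_0 G : opA_Lambda 0 G = 0.
Proof. by rewrite /opA_Lambda Lambda_0 linear0. Qed.

Lemma ratr_invn (k : nat) : (ratr k%:R^-1 : C) = k%:R^-1.
Proof. by rewrite fmorphV rmorph_nat. Qed.

(** The part [-Lam] of [(A - I) Lam] is moved to the left, where it completes [Lam] to
    [E(X) Lam]. *)
Lemma ad_series_expm1_Lambda s G :
  ad_series lam expm1_coef (Lambda lam) (Lambda lam) s G =
  ad_series lam exp_coef (Lambda lam) id_family s G +
  (ad_series lam expm1_coef (Lambda lam) opA_Lambda s G - opA_Lambda s G).
Proof.
case: s => [|s]; first by rewrite !ad_series0 opA_Lambda_0 subr0 addr0.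
have := Lambda_expansion s.+1 G.
pose D : family := fun s G => -1 *: Lambda lam s G + opA_Lambda s G.
have -> : (fun s G => opA lam (Lambda lam s G) - Lambda lam s G) = D.
  by apply/funext => t; apply/funext => G'; rewrite /D scaleN1r addrC.
have -> : \sum_(1 <= k < s.+1) (k.+1`!%:R : C)^-1 *:
      ad_iter lam (Lambda lam) k D s.+1 G
    = ad_series lam expm1_coef (Lambda lam) D s.+1 G - D s.+1 G.
  rewrite [in RHS]/ad_series [in RHS]big_ltn // [ad_iter _ _ 0 _ _ _]/(D s.+1 G).
  rewrite ratr_invn invr1 scale1r addrC addKr.
  by apply: eq_bigr => k _; rewrite ratr_invn.
rewrite ad_series_lin scaleN1r.
have -> : \sum_(0 <= k < s.+1) (k`!%:R : C)^-1 *: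
      ad_iter lam (Lambda lam) k id_family s.+1 G
    = ad_series lam exp_coef (Lambda lam) id_family s.+1 G.
  by apply: eq_bigr => k _; rewrite ratr_invn.
rewrite /D scaleN1r opprD opprK (AC (1*((2)*2)) (1*(3*5)*2*4)) => /eqP.
by rewrite -subr_eq subrr eq_sym subr_eq0 => /eqP <-.
Qed.

(** Multiplication by [b = 1 / E], using [b(x) e^x = b(-x)] and [b (E - 1) = 1 - b]. *)
Lemma Lambda_series s G :
  Lambda lam s G =
  ad_series lam (alternate bernoulli_coef) (Lambda lam) id_family s G +
  (opA_Lambda s G - ad_series lam bernoulli_coef (Lambda lam) opA_Lambda s G).
Proof.
rewrite -{1}(@ad_series1 _ _ lam (Lambda lam) (Lambda lam)) //.
rewrite -bernoulli_expm1 -ad_series_comp //.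
rewrite (@ad_series_ext _ _ _ _ _ _ (fun s G =>
  1 *: ad_series lam exp_coef (Lambda lam) id_family s G +
  (-1 *: opA_Lambda s G + ad_series lam expm1_coef (Lambda lam) opA_Lambda s G)));
  last first.
  move=> t _ G'; rewrite scale1r scaleN1r ad_series_expm1_Lambda.
  by rewrite [- _ + _]addrC.
rewrite !ad_series_lin scale1r scaleN1r !ad_series_comp //.
by rewrite bernoulli_exp bernoulli_expm1 ad_series1 // [- _ + _]addrC.
Qed.

Lemma Lambda_functional s G :
  Lambda lam s G =
  \sum_(0 <= k < s) (ratr (J_coef k.+1) : C) *:
      ad_iter lam (Lambda lam) k id_family s G +
  \sum_(1 <= k < s) (ratr (L_coef k) : C) *:
      ad_iter lam (Lambda lam) k (fun s G => opA lam (Lambda lam s G)) s G.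
Proof.
rewrite Lambda_series; congr (_ + _).
  by apply: eq_bigr => k _; rewrite /alternate /bernoulli_coef mulrA.
case: s => [|s]; first by rewrite opA_Lambda_0 ad_series0 subr0 big_geq.
(* The term [k = 0] has coefficient [B_0 = 1] and cancels [A Lam]. *)
rewrite /ad_series big_ltn // [ad_iter _ _ 0 _ _ _]/(opA_Lambda s.+1 G).
rewrite rmorph1 scale1r opprD addNKr -sumrN; apply: eq_bigr => k _.
by rewrite /L_coef mulNr rmorphN scaleNr.
Qed.

End LambdaEquation.
Arguments id_family {R n}.

(** * The functional equation of the tree sum *)

Lemma mtree_enum_uniq d : uniq (mtree_enum d).
Proof.
elim: d => //= d IHd; rewrite cat_uniq mem_cat; apply/andP; split.
  by apply/norP; split; apply/allpairsP => -[p []].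
apply/and3P; split.
- by apply: allpairs_uniq => // -[l r] [l' r'] _ _ /= [-> ->].
- by apply/hasP => -[_ /allpairsP[p [_ _ ->]] /allpairsP[q []]].
- by apply: allpairs_uniq => // -[l r] [l' r'] _ _ /= [-> ->].
Qed.

Section TreeSums.
Variable V : nmodType.

(** Replaces the finite type by a recursive list that can be unfolded at the root; the list may also
    hold trees with other numbers of leaves, hence the filter. *)
Lemma sum_marked_tree (F : mtree -> V) s d : (s <= d)%N ->
  \sum_(t : marked_tree s) F t = \sum_(t <- mtree_enum d | nleaves t == s) F t.
Proof.
move=> sd; rewrite -(big_map val xpredT) -[RHS]big_filter; apply: perm_big.
apply: uniq_perm; first by rewrite map_inj_uniq ?index_enum_uniq //; exact: val_inj.
  by rewrite filter_uniq ?mtree_enum_uniq.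
move=> t; rewrite mem_filter; apply/mapP/andP => [[u _ ->]|[ts _]].
  by split; [exact: (valP u)|apply: mem_mtree_enum; rewrite (eqP (valP u))].
by exists (MarkedTree ts); rewrite ?mem_index_enum.
Qed.

Lemma sum_marked_node (F : mtree -> V) b d :
  \sum_(t <- [seq Node b l r | l <- mtree_enum d, r <- mtree_enum d]
         | nleaves t == d.+1) F t =
  \sum_(1 <= a < d.+1) \sum_(l : marked_tree a) \sum_(r : marked_tree (d.+1 - a))
     F (Node b l r).
Proof.
rewrite big_mkcond big_allpairs_dep /=.
transitivity (\sum_(1 <= a < d.+1) \sum_(l <- mtree_enum d | a == nleaves l)
   \sum_(r <- mtree_enum d | (nleaves r == d.+1 - a)%N) F (Node b l r)); last first.
  apply: eq_big_nat => a /andP[a_gt0 a_lt].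
  rewrite (@sum_marked_tree
    (fun l => \sum_(r : marked_tree (d.+1 - a)) F (Node b l r)) a d) //.
  apply: eq_big => [l|l _]; first exact: eq_sym.
  by rewrite (@sum_marked_tree (fun r => F (Node b l r)) _ d) //
    leq_subLR -(prednK a_gt0) addSn ltnS leq_addl.
(* For a fixed left subtree [l] only [a = nleaves l] survives. *)
rewrite [RHS](exchange_big_dep xpredT) //=; apply: eq_bigr => l _.
rewrite big_nat1_eq nleaves_gt0 -big_mkcond /= ltnS; case: leqP => [le_ld|lt_dl].
  by apply: eq_bigl => r; rewrite -[RHS](eqn_add2l (nleaves l)) subnKC // ltnW.
apply: big1 => r /eqP eq_d; have := leq_add lt_dl (nleaves_gt0 r).
by rewrite eq_d addn1 ltnn.
Qed.

End TreeSums.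

(** * Cutting trees along the root line *)

Section TreeExpansion.
Variables (R : realType) (n : nat) (lam : 'rV[R[i]]_n).
Local Notation C := R[i].
Local Notation family := (nat -> multiop R n).

(** The case [c = 0] is the sum of the theorem; larger [c] arise when unmarked roots are cut off. *)
Definition tree_family (c : nat) : family := fun s G =>
  \sum_(t : marked_tree s) (ratr (spine_mu c t) : C) *: treeop lam t G.

Lemma tree_family0 c G : tree_family c 0 G = 0.
Proof. by apply: big1 => t _; have := nleaves_gt0 t; rewrite (eqP (valP t)). Qed.

Lemma ad_sum_node (w : mtree -> rat) (Q : mtree -> multiop R n) s G :
  \sum_(1 <= a < s) \sum_(l : marked_tree a) \sum_(r : marked_tree (s - a))
     (ratr (mu l * w r) : C) *: adB lam (treeop lam l (take (nleaves l) G))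
       (Q r (drop (nleaves l) G)) =
  ad_sum lam (tree_family 0)
    (fun s G => \sum_(r : marked_tree s) (ratr (w r) : C) *: Q r G) s G.
Proof.
apply: eq_bigr => a _; rewrite adB_suml; apply: eq_bigr => l _.
rewrite -mu_spine (eqP (valP l)) linear_sum scaler_sumr; apply: eq_bigr => r _.
by rewrite linearZ scalerA rmorphM.
Qed.

(** The three terms are the trees that are a leaf, have a marked root, or have an unmarked root. *)
Lemma tree_family_rec c s G :
  tree_family c s G =
  (ratr (J_coef c.+1) : C) *: id_family s G +
  ((ratr (L_coef c.+1) : C) *:
     ad_sum lam (tree_family 0) (fun s G => opA lam (tree_family 0 s G)) s G +
   ad_sum lam (tree_family 0) (tree_family c.+1) s G).
Proof.
case: s => [|d].
  by rewrite tree_family0 /ad_sum !big_geq // /id_family /= !scaler0 !addr0.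
rewrite {1}/tree_family.
rewrite (@sum_marked_tree _
  (fun t => (ratr (spine_mu c t) : C) *: treeop lam t G) _ d.+1) //.
rewrite big_mkcond big_cons -big_mkcond big_cat !sum_marked_node.
congr (_ + (_ + _)).
- by rewrite /id_family spine_mu_leaf /= eq_sym; case: ifP; rewrite ?scaler0.
- transitivity (ad_sum lam (tree_family 0) (fun s G =>
      \sum_(r : marked_tree s) (ratr (L_coef c.+1 * mu r) : C) *:
         opA lam (treeop lam r G)) d.+1 G).
    rewrite -(@ad_sum_node (fun r => L_coef c.+1 * mu r)
       (fun r G => opA lam (treeop lam r G))).
    apply: eq_bigr => a _; apply: eq_bigr => l _; apply: eq_bigr => r _.
    by rewrite spine_mu_marked.
  rewrite /ad_sum scaler_sumr; apply: eq_bigr => a _.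
  rewrite -[RHS]linearZ; congr adB; rewrite linear_sum scaler_sumr.
  by apply: eq_bigr => r _; rewrite linearZ scalerA rmorphM mu_spine.
- rewrite -[RHS](@ad_sum_node (spine_mu c.+1) (treeop lam)).
  apply: eq_bigr => a _; apply: eq_bigr => l _; apply: eq_bigr => r _.
  by rewrite spine_mu_unmarked.
Qed.

(** Descent of [N] vertices along the root line: it ends at a leaf with a factor [J] or at a first
    mark with a factor [L]; the remainder collects trees where neither has occurred. *)
Lemma tree_family_iter N s G :
  tree_family 0 s G =
  \sum_(0 <= k < N) (ratr (J_coef k.+1) : C) *:
     ad_iter lam (tree_family 0) k id_family s G +
  \sum_(1 <= k < N.+1) (ratr (L_coef k) : C) *:
     ad_iter lam (tree_family 0) k (fun s G => opA lam (tree_family 0 s G)) s G +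
  ad_iter lam (tree_family 0) N (tree_family N) s G.
Proof.
elim: N => [|N IHN]; first by rewrite !big_geq // !add0r.
rewrite [X in _ = X + _ + _]big_nat_recr //= [X in _ = _ + X + _]big_nat_recr //= IHN.
have -> : tree_family N = (fun s G =>
  (ratr (J_coef N.+1) : C) *: id_family s G +
  ((ratr (L_coef N.+1) : C) *:
     ad_sum lam (tree_family 0) (fun s G => opA lam (tree_family 0 s G)) s G +
   ad_sum lam (tree_family 0) (tree_family N.+1) s G)).
  by apply/funext => t; apply/funext => G'; rewrite tree_family_rec.
rewrite 2!ad_iter_lin /ad_iter -!iterSr -!addrA; congr (_ + _).
by rewrite addrCA.
Qed.

Lemma tree_family_functional s G :
  tree_family 0 s G =
  \sum_(0 <= k < s) (ratr (J_coef k.+1) : C) *: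
     ad_iter lam (tree_family 0) k id_family s G +
  \sum_(1 <= k < s) (ratr (L_coef k) : C) *:
     ad_iter lam (tree_family 0) k (fun s G => opA lam (tree_family 0 s G)) s G.
Proof.
have AT0 G' : opA lam (tree_family 0 0 G') = 0 by rewrite tree_family0 linear0.
(* With [N = s] the remainder vanishes, since [s] brackets use up all arguments. *)
rewrite (tree_family_iter s) [X in _ + X]ad_iter_vanish ?addr0 //;
  last exact: tree_family0.
case: s => [|s]; first by rewrite !big_geq.
(* For the same reason the last term of the [L] sum, at [k = s], is zero. *)
rewrite [X in _ + X]big_nat_recr // [X in _ + (_ + _ *: X)]ad_iter_vanish //.
by rewrite scaler0 addr0.
Qed.

(** Uniqueness of the solution: the [J] sum brackets only with lower arities, and the [L] sum starts
    at [k = 1], so [A Lam] too is reached only below [s]. *)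
Lemma Lambda_tree s G : Lambda lam s G = tree_family 0 s G.
Proof.
elim/ltn_ind: s G => s IHs G.
rewrite Lambda_functional tree_family_functional.
congr (_ + _); apply: eq_big_nat => k /andP[k_gt0 k_lt]; congr (_ *: _).
  exact: ad_iter_ext.
apply: ad_iter_ext => // t t_le G'; rewrite IHs //.
by rewrite (leq_trans _ t_le) // -addn1 leq_add2l.
Qed.

End TreeExpansion.

Theorem theorem3 (R : realType) (n : nat) (hn : (1 <= n)%N) (lam : 'rV[R[i]]_n)
    (s : nat) (hs : (1 <= s)%N) (G : s.-tuple (F_space R n)) :
  Lambda lam s G =
  \sum_(t : marked_tree s) (ratr (mu t) : R[i]) *: treeop lam t G.
Proof.
by rewrite Lambda_tree; apply: eq_bigr => t _; rewrite mu_spine.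
Qed.
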